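(* Let $g:\mathbb{R}\to\mathbb{R}$ be Lipschitz continuous, $\mathbb{Z}$-periodic and such that $g(y)>0$ for every $y$, let $u_0:\mathbb{R}^n\to\mathbb{R}$ be Lipschitz continuous, and let $\alpha>1$. For $\varepsilon>0$ let $u^\varepsilon_\alpha$ be the solution to $$u^\varepsilon_t-\varepsilon^\alpha\Delta u^\varepsilon-g\left(\frac{u^\varepsilon}{\varepsilon}\right)=0\ \text{ in }\mathbb{R}^n\times(0,+\infty),\qquad u^\varepsilon(x,0)=u_0(x)\ \text{ in }\mathbb{R}^n.$$ Then $$\lim_{\varepsilon\to0}u^\varepsilon_\alpha(x,t)=u_0(x)+t\left(\int_0^1\frac{1}{g(s)}\,ds\right)^{-1}\qquad\text{locally uniformly.}$$
   Context: $\Delta$ is the Laplacian in $x$. The solution $u^\varepsilon_\alpha$ is the unique (classical) solution, of class $C^{2+\gamma,1+\gamma/2}$ for all $\gamma\in(0,1)$. Locally uniform convergence is on $\mathbb{R}^n\times[0,+\infty)$. *)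

(* Defs.v *)
From mathcomp Require Export all_boot all_order all_algebra.
From mathcomp Require Export all_classical all_reals all_analysis.

Set Implicit Arguments.
Unset Strict Implicit.
Unset Printing Implicit Defensive.

Export Order.TTheory GRing.Theory Num.Theory.
Export numFieldNormedType.Exports.

Local Open Scope classical_set_scope.
Local Open Scope ring_scope.

(* A function of space and time is a function of p = (x, t) : 'rV[R]_n * R.
   R^n carries the sup norm of 'rV[R]_n; Lipschitz continuity, the Hoelder
   classes and the growth condition below do not depend on the choice of
   norm. *)
Section SpaceTime.
Context {R : realType} {n : nat}.
Implicit Types (w : 'rV[R]_n * R -> R) (p : 'rV[R]_n * R) (i j : 'I_n).

Definition dt w p : R := derive1 (fun s : R => w (p.1, s)) p.2.

Definition dx i w p : R :=
  'D_(delta_mx 0 i) (fun y : 'rV[R]_n => w (y, p.2)) p.1.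

Definition laplacian w p : R := \sum_(i < n) dx i (dx i w) p.

Definition parabolic_holder_on (gamma : R) (K : set ('rV[R]_n * R)) w : Prop :=
  exists C : R, forall p q, K p -> K q ->
    `|w p - w q| <= C * (`|p.1 - q.1| `^ gamma + `|p.2 - q.2| `^ (gamma / 2)).

(* The local space C^{2+gamma,1+gamma/2} over R^n x (0,+oo): the derivatives
   D_x^b D_t^k w with |b| + 2k <= 2 exist and satisfy a parabolic Hoelder
   condition on every compact subset. *)
Definition parabolic_C2 (gamma : R) w : Prop :=
  [/\ forall p, 0 < p.2 ->
        [/\ derivable (fun s : R => w (p.1, s)) p.2 1,
            forall i,
              derivable (fun y : 'rV[R]_n => w (y, p.2)) p.1 (delta_mx 0 i)
          & forall i j,
              derivable (fun y : 'rV[R]_n => dx i w (y, p.2)) p.1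
                (delta_mx 0 j)]
    & forall K : set ('rV[R]_n * R), compact K -> K `<=` [set p | 0 < p.2] ->
        [/\ parabolic_holder_on gamma K w,
            parabolic_holder_on gamma K (dt w),
            forall i, parabolic_holder_on gamma K (dx i w)
          & forall i j, parabolic_holder_on gamma K (dx j (dx i w))]].

(* Tychonoff's class, in which the Cauchy problem has a unique classical
   solution; without a restriction on the growth in x uniqueness fails already
   for the heat equation. *)
Definition tychonoff_growth w : Prop :=
  forall T : R, 0 < T -> exists C a : R, forall p,
    0 <= p.2 <= T -> `|w p| <= C * expR (a * `|p.1| ^+ 2).

Definition classical_solution (g : R -> R) (u0 : 'rV[R]_n -> R)
    (alpha eps : R) w : Prop :=
  [/\ {within [set p | 0 <= p.2], continuous w},
      forall gamma : R, 0 < gamma < 1 -> parabolic_C2 gamma w,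
      forall p, 0 < p.2 ->
        dt w p - eps `^ alpha * laplacian w p - g (w p / eps) = 0,
      forall x, w (x, 0) = u0 x
    & tychonoff_growth w].

End SpaceTime.

(* Main.v *)
Require Import Defs.
From mathcomp Require Import ring lra.

(** The right-hand side g (u / eps) oscillates at scale eps, and the effect is
    that of the ordinary differential equation y' = g y, whose solutions advance
    by one period in time 1 / c, where 1 / c is the mean of 1 / g.  Let Phi be
    the primitive of c / g and Psi its inverse, so that Psi' = g (Psi) / c and
    Psi stays at bounded distance from the identity ([corrector_exists]).  In
    the variable phi defined by u = eps * Psi (phi / eps) the equation becomes,
    formally,

      phi_t - eps^alpha Lap phi - eps^(alpha-1) (Psi'' / Psi') |grad phi|^2 = c

    and |u - phi| = O(eps).  As alpha > 1, for a smooth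
    phi of bounded gradient and Hessian both second-order terms are small, so
    that phi = phi0 + (c + o(1)) t is a supersolution as soon as the o(1) is
    chosen large enough.

    Since u0 is only Lipschitz, it is not regularized globally.  To bound u at
    one point x0, phi0 is taken to be the smoothed cone
    u0 x0 + L sqrt (eta^2 + |x - x0|^2), which lies above u0 everywhere and
    exceeds it by L eta only at x0 ([barrier_supersolution],
    [subsolution_le]).  The constants do not depend on x0, and the lower bound
    is the upper bound applied to - u, which solves the equation for
    y |-> - g (- y).

    The comparison of u with such a barrier takes place on an unbounded domain,
    for functions that may grow like exp (a |x|^2).  It is carried out on short
    time intervals ([comparison_step]) by maximizing the quotient of the
    difference by a weight H that grows faster and is a strict supersolution of
    the linearized equation; the intervals have a fixed length, so finitely many
    cover [0, T] ([comparison]).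

    As g is only Lipschitz, Psi is C^{1,1} and the barrier is not C^2.  This is
    harmless because a maximum only sees one-sided quadratic bounds.  So sub-
    and supersolutions are expressed through upper jets, as in the theory of
    viscosity solutions, and all barriers are handled by explicit second-order
    upper bounds instead of derivatives. *)

Set Implicit Arguments.
Unset Strict Implicit.
Unset Printing Implicit Defensive.

Local Open Scope classical_set_scope.
Local Open Scope ring_scope.

(** * Consequences of Lipschitz continuity and periodicity *)

Lemma lipschitz_bound (R : realType) (V W : normedModType R) (f : V -> W) :
  lipschitz f -> exists2 L : R, 0 < L & forall x y, `|f x - f y| <= L * `|x - y|.
Proof.
move=> [M [_ fM]]; have M1 : M < `|M| + 1 by have := ler_norm M; lra.
exists (`|M| + 1) => [|x y]; first by have := normr_ge0 M; lra.
exact: (fM _ M1 (x, y)).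
Qed.

Lemma modulus_continuous (R : realType) (V W : normedModType R) (f : V -> W) (L : R) :
  (forall x y, `|f x - f y| <= L * `|x - y|) -> continuous f.
Proof.
move=> fL x; apply/cvgrPdist_le => e e0.
have L1 : 0 < `|L| + 1 by have := normr_ge0 L; lra.
near=> y; apply: (le_trans (fL x y)).
apply: (@le_trans _ _ ((`|L| + 1) * `|x - y|)).
  by apply: ler_wpM2r => //; have := ler_norm L; lra.
rewrite mulrC -ler_pdivlMr//; near: y.
by apply: cvgr_dist_le; [exact: cvg_id|exact: divr_gt0].
Unshelve. all: by end_near. Qed.

Lemma periodic_int (R : realType) (g : R -> R) : periodic g 1 ->
  forall y, exists2 s, s \in `[0, 1] & g y = g s.
Proof.
move=> gp y.
have gn (k : nat) z : g (z + k%:R) = g z by rewrite (periodicn gp).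
have gz (k : int) z : g (z + k%:~R) = g z.
  case: k => k; first exact: gn.
  by rewrite NegzE mulrNz -[in RHS](subrK (k.+1%:~R : R) z) gn.
exists (y + (- Num.floor y)%:~R); last by rewrite gz.
rewrite in_itv/= mulrNz.
by have := floor_le y; have := floorD1_gt y; rewrite intrD; lra.
Qed.

(** * The corrector *)

Section Primitive.
Context {R : realType} (f : R -> R).
Hypothesis cf : continuous f.
Notation mu := (@lebesgue_measure R).

Definition primitive y : R :=
  if 0 <= y then \int[mu]_(s in `[0, y]) f s else - \int[mu]_(s in `[y, 0]) f s.

Let intf a b : mu.-integrable `[a, b] (EFin \o f).
Proof.
apply: continuous_compact_integrable; first exact: segment_compact.
exact: continuous_subspaceT.
Qed.

Lemma Rintegral_itv_split a b c : a <= b -> b <= c ->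
  \int[mu]_(s in `[a, c]) f s =
  \int[mu]_(s in `[a, b]) f s + \int[mu]_(s in `[b, c]) f s.
Proof.
move=> ab bc; have := @Rintegral_itvB R f (BLeft a) (BRight c) b (intf a c).
rewrite !bnd_simp => /(_ ab bc); rewrite Rintegral_itv_obnd_cbnd; last first.
  by apply: integrableS (intf b c) => //; exact: subset_itv_oc_cc.
by move=> <-; rewrite addrC subrK.
Qed.

Lemma Rintegral_itv_xx a : \int[mu]_(s in `[a, a]) f s = 0.
Proof. by rewrite set_itv1 Rintegral_set1. Qed.

Lemma primitiveB x y : x <= y ->
  primitive y - primitive x = \int[mu]_(s in `[x, y]) f s.
Proof.
move=> xy; rewrite /primitive; case: ifPn => y0; case: ifPn => x0.
- by rewrite (Rintegral_itv_split x0 xy); lra.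
- rewrite (@Rintegral_itv_split x 0 y)//; first lra.
  by move: x0; rewrite -ltNge; lra.
- exfalso; move: y0 x0; rewrite -ltNge; lra.
- rewrite (@Rintegral_itv_split x y 0)//; first lra.
  by move: y0; rewrite -ltNge; lra.
Qed.

Lemma Rintegral_itv_bounds a b x y : x <= y ->
  (forall s, x <= s <= y -> a <= f s <= b) ->
  a * (y - x) <= \int[mu]_(s in `[x, y]) f s <= b * (y - x).
Proof.
move=> xy ab.
have cst r : \int[mu]_(s in `[x, y]) (r : R) = r * (y - x).
  rewrite Rintegral_cst//= lebesgue_measure_itv/= lte_fin.
  by case: ltgtP xy => [||->] //=; rewrite ?subrr.
have ic r : mu.-integrable `[x, y] (EFin \o (fun=> r)).
  apply: continuous_compact_integrable; first exact: segment_compact.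
  by apply: continuous_subspaceT; exact: cst_continuous.
rewrite -2!cst; apply/andP; split; apply: le_Rintegral => //.
- by move=> s /=; rewrite in_itv/= => /ab/andP[].
- by move=> s /=; rewrite in_itv/= => /ab/andP[].
Qed.

(** This quadratic estimate is the only differentiability of the primitive that
    is needed; it spares a separate treatment of one-sided derivatives at 0. *)
Lemma primitive_taylor K : (forall x y, `|f x - f y| <= K * `|x - y|) ->
  forall x y, `|primitive y - primitive x - f x * (y - x)| <= K * (y - x) ^+ 2.
Proof.
move=> fK.
have bnd z x y : x <= y -> z \in `[x, y] ->
    (f z - K * (y - x)) * (y - x) <= primitive y - primitive x
      <= (f z + K * (y - x)) * (y - x).
  move=> xy; rewrite in_itv/= => /andP[xz zy].
  rewrite primitiveB//; apply: Rintegral_itv_bounds => // s /andP[xs sy].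
  rewrite -ler_distl; apply: le_trans (fK _ _) _; apply: ler_wpM2l.
    by have := fK 1 0; have := normr_ge0 (f 1 - f 0); rewrite subr0 normr1; lra.
  by rewrite ler_norml; lra.
move=> x y; have [xy|/ltW yx] := leP x y.
  have := bnd x x y xy; rewrite in_itv/= lexx xy => /(_ isT).
  by rewrite ler_norml; lra.
have := bnd x y x yx; rewrite in_itv/= lexx yx => /(_ isT).
by rewrite ler_norml; lra.
Qed.

End Primitive.

(** Used to see that the increment of a primitive over one period is
    constant. *)
Lemma quadratic_modulus_cst (R : realType) (D : R -> R) (K : R) :
  (forall x y, `|D y - D x| <= K * (y - x) ^+ 2) -> forall x y, D x = D y.
Proof.
move=> DK x y; apply: is_derive_0_is_cst => {x y} x.
have D0 : (fun h => h^-1 *: (D (h + x) - D x)) @ 0^' --> (0 : R).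
  apply/cvgrPdist_le => e e0; near=> h; rewrite sub0r normrN /= normrM normfV.
  have h0 : h != 0 by near: h; exact: nbhs_dnbhs_neq.
  rewrite mulrC ler_pdivrMr ?normr_gt0//; apply: (le_trans (DK _ _)).
  rewrite addrK -real_normK ?num_real// expr2 mulrA ler_wpM2r//.
  have K1 : 0 < `|K| + 1 by have := normr_ge0 K; lra.
  have : `|h| <= e / (`|K| + 1).
    by near: h; apply: dnbhs0_le; exact: divr_gt0.
  rewrite ler_pdivlMr// => hK; apply: le_trans hK; rewrite mulrC ler_wpM2l//.
  by have := ler_norm K; lra.
have := D0; under eq_fun do rewrite -[X in D (X + _)]mulr1.
move=> D0'; apply: DeriveDef; first by apply/cvg_ex; exists 0.
exact/cvg_lim.
Unshelve. all: by end_near. Qed.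

Lemma periodic_continuous_bounds (R : realType) (g : R -> R) : continuous g ->
  periodic g 1 -> (forall y, 0 < g y) ->
  exists a b : R, 0 < a /\ forall y, a <= g y <= b.
Proof.
move=> cg gp g0.
have cI : {within `[0, 1], continuous g} by exact: continuous_subspaceT.
have [xa _ xamin] := EVT_min ler01 cI; have [xb _ xbmax] := EVT_max ler01 cI.
exists (g xa), (g xb); split=> // y; have [s sI ->] := periodic_int gp y.
by rewrite xamin// xbmax.
Qed.

(** Psi is the inverse of a primitive of 1 / G; the last condition is the
    quantitative form of Psi' = G (Psi) that survives when G is only Lipschitz. *)
Definition corrector (R : realType) (G Psi : R -> R) (a b B K : R) : Prop :=
  [/\ 0 < a /\ (forall y, a <= G y <= b),
      forall s, `|Psi s - s| <= B,
      forall s d, `|Psi (s + d) - Psi s| <= b * `|d|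
    & forall s d, `|Psi (s + d) - Psi s - G (Psi s) * d| <= K * d ^+ 2].

Lemma corrector_K_ge0 (R : realType) (G Psi : R -> R) (a b B K : R) :
  corrector G Psi a b B K -> 0 <= K.
Proof.
move=> [_ _ _ PsiK].
by have := le_trans (normr_ge0 _) (PsiK 0 1); rewrite expr1n mulr1.
Qed.

(** The symmetry u |-> - u of the problem, at the level of correctors. *)
Lemma corrector_opp (R : realType) (G Psi : R -> R) (a b B K : R) :
  corrector G Psi a b B K ->
  corrector (fun y => G (- y)) (fun s => - Psi (- s)) a b B K.
Proof.
move=> [[a0 Gab] PsiB Psib PsiK]; split=> [|s|s d|s d].
- by split=> // y; exact: Gab.
- by have := PsiB (- s); rewrite -normrN; congr (`|_| <= _); ring.
- rewrite -(normrN d) -[X in X <= _]normrN.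
  by have := Psib (- s) (- d); congr (`|_| <= _); rewrite (opprD s d); ring.
- have := PsiK (- s) (- d); rewrite -normrN sqrrN; congr (`|_| <= _).
  by rewrite !opprK !opprD; ring.
Qed.

(** Psi is the inverse of Phi = c P with P the primitive of 1 / g.  The choice of
    c makes Phi (y + 1) = Phi y + 1, whence Phi, and then Psi, stays at bounded
    distance from the identity; the bounds on 1 / g make Phi bi-Lipschitz; and
    the quadratic expansion of Phi is inverted into the one of Psi. *)
Lemma corrector_exists (R : realType) (g : R -> R) :
  lipschitz g -> periodic g 1 -> (forall y, 0 < g y) ->
  let c := (\int[lebesgue_measure]_(s in `[0, 1]) (g s)^-1)^-1 in
  0 < c /\ exists Psi a b B K, corrector (fun y => g y / c) Psi a b B K.
Proof.
move=> /lipschitz_bound[L L0 gL] gp g0 c.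
have [m [M [m0 gmM]]] := periodic_continuous_bounds (modulus_continuous gL) gp g0.
have M0 : 0 < M by have := gmM 0; lra.
pose h y := (g y)^-1.
have hmM y : M^-1 <= h y <= m^-1.
  by have /andP[mg gM] := gmM y; rewrite /h !lef_pV2 ?posrE// mg gM.
have hL x y : `|h x - h y| <= (L / m ^+ 2) * `|x - y|.
  have -> : h x - h y = (g y - g x) * (h x * h y).
    by rewrite /h; field; rewrite !gt_eqF.
  have hp z : 0 <= h z by rewrite invr_ge0 ltW.
  rewrite normrM (distrC (g y)) [X in _ * X]ger0_norm ?mulr_ge0//.
  rewrite mulrAC; apply: ler_pM => //; first by rewrite mulr_ge0.
  by rewrite expr2 invfM; apply: ler_pM => //; case/andP: (hmM x); case/andP: (hmM y).
have ch : continuous h := modulus_continuous hL.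
pose P := primitive h.
have PB x y : x <= y -> M^-1 * (y - x) <= P y - P x <= m^-1 * (y - x).
  by move=> xy; rewrite /P primitiveB//; apply: Rintegral_itv_bounds.
have P0 : P 0 = 0 by rewrite /P /primitive lexx Rintegral_itv_xx.
have PT := primitive_taylor ch hL.
have cE : c^-1 = P 1 by rewrite /c invrK /P /primitive ler01.
have c0 : 0 < c.
  rewrite -invr_gt0 cE; have := PB 0 1 ler01; rewrite P0 !subr0 mulr1.
  by move=> /andP[+ _]; apply: lt_le_trans; rewrite invr_gt0.
split=> //; clearbody c.
have Pper y : P (y + 1) = P y + c^-1.
  have hper z : h (z + 1) = h z by rewrite /h gp.
  suff : P (y + 1) - P y = P (0 + 1) - P 0 by rewrite P0 add0r cE; lra.
  apply: (@quadratic_modulus_cst _ (fun y => P (y + 1) - P y) (2 * (L / m ^+ 2))).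
  move=> x z; have := PT x z; have := PT (x + 1) (z + 1).
  rewrite hper (_ : z + 1 - (x + 1) = z - x); last by ring.
  by rewrite !ler_norml -/P; lra.
pose Phi y := c * P y.
have Phiper y : Phi (y + 1) = Phi y + 1.
  by rewrite /Phi Pper mulrDr divff ?gt_eqF.
pose B := c / m + 1.
have PhiB y : `|Phi y - y| <= B.
  have pp : periodic (fun y => Phi y - y) 1 by move=> z; rewrite Phiper; lra.
  have [s] := periodic_int pp y; rewrite in_itv/= => /andP[s0 s1] ->.
  have := PB 0 s s0; rewrite P0 !subr0 => /andP[lo hi].
  have : 0 <= Phi s.
    apply: mulr_ge0 (ltW c0) (le_trans _ lo).
    by rewrite mulr_ge0// invr_ge0 ltW.
  have : Phi s <= c / m.
    rewrite /Phi ler_pM2l//; apply: (le_trans hi).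
    by rewrite ler_piMr// invr_ge0 ltW.
  by rewrite ler_norml /B; lra.
have PhiL x y : `|Phi x - Phi y| <= (c / m) * `|x - y|.
  wlog xy : x y / x <= y.
    by move=> H; have [/H//|/ltW/H] := leP x y; rewrite distrC (distrC y).
  rewrite distrC (distrC x) /Phi -mulrBr normrM (gtr0_norm c0) -mulrA ler_pM2l//.
  have /andP[lo hi] := PB x y xy.
  rewrite !ger0_norm ?subr_ge0// -subr_ge0; apply: le_trans lo.
  by rewrite mulr_ge0 ?subr_ge0// invr_ge0 ltW.
have : forall s, exists y, Phi y = s.
  move=> s; have Bge : s - B <= s + B by have := le_trans (normr_ge0 _) (PhiB 0); lra.
  have cPhi : {within `[s - B, s + B], continuous Phi}.
    by apply: continuous_subspaceT; exact: modulus_continuous PhiL.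
  have [|y _ <-] := IVT (v := s) Bge cPhi; last by exists y.
  have := PhiB (s - B); have := PhiB (s + B).
  rewrite ge_min le_max !ler_norml => ? ?; apply/andP; split; apply/orP; [left|right]; lra.
move=> /choice[Psi PsiE].
have Psib s d : `|Psi (s + d) - Psi s| <= M / c * `|d|.
  have low x y : `|y - x| <= M / c * `|Phi y - Phi x|.
    wlog xy : x y / x <= y.
      by move=> H; have [/H//|/ltW/H] := leP x y; rewrite distrC (distrC (Phi x)).
    have /andP[lo _] := PB x y xy.
    rewrite ger0_norm ?subr_ge0//.
    apply: (@le_trans _ _ (M / c * (Phi y - Phi x))); last first.
      by rewrite ler_wpM2l ?ler_norm// divr_ge0 ?ltW.
    rewrite /Phi -mulrBr mulrA divfK ?gt_eqF//.
    by rewrite -ler_pdivrMl.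
  by have := low (Psi s) (Psi (s + d)); rewrite !PsiE (_ : s + d - s = d); last by ring.
exists Psi, (m / c), (M / c), B, (M / c * (c * (L / m ^+ 2) * (M / c) ^+ 2)); split.
- split=> [|y]; first exact: divr_gt0.
  by rewrite !ler_pdivrMr ?divfK ?gt_eqF.
- by move=> s; have := PhiB (Psi s); rewrite PsiE distrC.
- exact: Psib.
- move=> s d; set y := Psi s; set z := Psi (s + d).
  have := ler_wpM2l (ltW c0) (PT y z).
  rewrite -[X in X * `|_|](gtr0_norm c0) -normrM.
  have -> : c * (primitive h z - primitive h y - h y * (z - y)) =
      d - (z - y) / (g y / c).
    have : Phi z - Phi y = d by rewrite !PsiE; ring.
    rewrite /Phi -/P => <-; rewrite /h; field.
    by rewrite !gt_eqF// divr_gt0.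
  have Gy : 0 < g y / c by rewrite divr_gt0.
  move=> /(ler_wpM2l (ltW Gy)); rewrite -[X in X * `|_|](gtr0_norm Gy) -normrM.
  have -> : g y / c * (d - (z - y) / (g y / c)) = - (z - y - g y / c * d).
    by field; rewrite !gt_eqF.
  rewrite normrN => /le_trans; apply.
  have Kh0 : 0 <= L / m ^+ 2 by rewrite ltW// divr_gt0// exprn_gt0.
  have -> : M / c * (c * (L / m ^+ 2) * (M / c) ^+ 2) * d ^+ 2 =
      M / c * (c * (L / m ^+ 2 * (M / c * `|d|) ^+ 2)).
    by rewrite -(real_normK (num_real d)); ring.
  apply: ler_pM.
  + exact: ltW.
  + by rewrite mulr_ge0 ?(ltW c0)// mulr_ge0// sqr_ge0.
  + by rewrite ler_pM2r ?invr_gt0//; case/andP: (gmM y).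
  + rewrite ler_pM2l//; apply: ler_wpM2l => //.
    rewrite -(real_normK (num_real (z - y))).
    by rewrite ler_sqr ?nnegrE// ?(le_trans _ (Psib s d)).
Qed.

(** * One-dimensional derivative tests *)

Lemma is_derive_expansion (R : realType) (f : R -> R) (x d : R) :
  is_derive x 1 f d -> forall e, 0 < e -> exists2 r, 0 < r &
    forall h, `|h| < r -> `|f (x + h) - f x - d * h| <= e * `|h|.
Proof.
move=> [df fd] e e0.
have /cvg_ex[l /= lim_l] := df.
have ld : l = d by rewrite -fd; apply/esym/cvg_lim.
move: lim_l; rewrite ld => /cvgrPdist_le/(_ _ e0)/nbhs_ballP[r /= r0 rP].
exists r => // h hr; have [->|h0] := eqVneq h 0.
  by rewrite addr0 subrr mulr0 subrr normr0 mulr0.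
have /= := rP h _ h0; rewrite -ball_normE /= sub0r normrN => /(_ hr).
rewrite /GRing.scale /= mulr1 -ler_pdivrMr ?normr_gt0// -normfV -normrM.
by congr (_ <= _); rewrite -normrN (addrC x); congr `|_|; field.
Qed.

Lemma derivative_left_expansion_ge (R : realType) (f : R -> R) (t d m C r : R) :
  is_derive t 1 f d -> 0 < r ->
  (forall h, 0 <= h <= r -> f (t - h) <= f t - m * h + C * h ^+ 2) -> m <= d.
Proof.
move=> fd r0 fm; rewrite leNgt; apply/negP => dm.
have [e e0 eE] : exists2 e, 0 < e & e * 2 = m - d by exists ((m - d) / 2); lra.
have [r' r'0 fe] := is_derive_expansion fd e0.
have C1 : 0 < `|C| + 1 by have := normr_ge0 C; lra.
pose h := Num.min (Num.min r (r' / 2)) (e / 2 / (`|C| + 1)).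
have h0 : 0 < h by rewrite !lt_min r0 /= !divr_gt0.
have hr : h <= r by rewrite !ge_min lexx.
have hr' : h < r' by apply: (@le_lt_trans _ _ (r' / 2)); [rewrite !ge_min lexx orbT|lra].
have hC : C * h <= e / 2.
  have : h <= e / 2 / (`|C| + 1) by rewrite ge_min lexx orbT.
  rewrite ler_pdivlMr// => /(le_trans _); apply.
  by rewrite mulrC ler_wpM2l// ?ltW//; have := ler_norm C; lra.
have := fe (- h); rewrite normrN gtr0_norm// => /(_ hr').
have := fm h; rewrite hr ltW// => /(_ isT).
rewrite ler_norml => lo /andP[hi _].
have : (m - d - e) * h <= (C * h) * h by rewrite -mulrA -expr2; lra.
by rewrite ler_pM2r//; lra.
Qed.

(** The first-order coefficient l is not related to the derivative of f
    beforehand: symmetrizing f removes it, and the symmetrized function would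
    increase to the right of 0 by the mean value theorem if d exceeded 2 q. *)
Lemma second_derivative_le (R : realType) (f f' : R -> R) (d l q r : R) :
  (forall h : R, is_derive h 1 f (f' h)) -> is_derive (0 : R) 1 f' d -> 0 < r ->
  (forall h, `|h| <= r -> f h <= f 0 + l * h + q * h ^+ 2) -> d <= 2 * q.
Proof.
move=> ff' f'd r0 fq; rewrite leNgt; apply/negP => dq.
have [e e0 eE] : exists2 e, 0 < e & e * 2 = d - 2 * q.
  by exists ((d - 2 * q) / 2); lra.
have [r' r'0 fe] := is_derive_expansion f'd e0.
pose h := Num.min r (r' / 2).
have h0 : 0 < h by rewrite lt_min r0 divr_gt0.
have hr : h <= r by rewrite ge_min lexx.
have hr' : h < r' by apply: (@le_lt_trans _ _ (r' / 2)); [rewrite ge_min lexx orbT|lra].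
pose k s := f s + f (- s) - 2 * q * s ^+ 2.
pose k' s := f' s - f' (- s) - 4 * q * s.
have kk' (s : R) : is_derive s 1 k (k' s).
  have fN : is_derive s 1 (f \o -%R) (- f' (- s)).
    have := @is_derive1_comp _ f -%R s _ _ (ff' (- s)) (is_deriveNid s 1).
    by rewrite mulrN1.
  have sq : is_derive s 1 ((2 * q) \*: ((id : R -> R) ^+ 2)) (4 * q * s).
    apply: is_derive_eq.
    by rewrite /GRing.scale /= expr1; ring.
  exact: (is_deriveB (is_deriveD (ff' s) fN) sq).
have ck : {within `[0, h], continuous k}.
  apply: derivable_within_continuous => s _.
  by have [] := kk' s.
have [s] := MVT h0 (fun s _ => kk' s) ck.
rewrite in_itv/= => /andP[s0 sh] kE.
have : k h - k 0 <= 0.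
  have := fq h; have := fq (- h); rewrite normrN gtr0_norm// => /(_ hr) + /(_ hr).
  by rewrite /k sqrrN oppr0 expr0n/=; lra.
rewrite kE pmulr_lle0 ?subr_gt0//.
have := fe s; have := fe (- s); rewrite normrN gtr0_norm//.
rewrite !add0r => /(_ (lt_trans sh hr')) + /(_ (lt_trans sh hr')).
rewrite !ler_norml /k' => /andP[_ lo] /andP[lo' _].
have : 0 < e * s by rewrite mulr_gt0.
by rewrite -(ltr_pM2r s0) in e0; nra.
Qed.

(** * Upper jets and viscosity sub- and supersolutions *)

Lemma is_derive_along (R : realType) (V : normedModType R) (f : V -> R) (x v : V) (h : R) :
  derivable f (x + h *: v) v ->
  is_derive h 1 (fun s => f (x + s *: v)) ('D_v f (x + h *: v)).
Proof.
move=> df.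
have E : (fun k : R => k^-1 *: (f (x + (k *: 1 + h) *: v) - f (x + h *: v))) =
         (fun k : R => k^-1 *: ((f \o shift (x + h *: v)) (k *: v) - f (x + h *: v))).
  apply/funext => k /=; congr (_ *: (f _ - _)).
  by rewrite scalerDl [k *: 1]mulr1 addrCA.
by apply: DeriveDef; rewrite /derivable /derive /= E.
Qed.

Section Viscosity.
Context {R : realType} {n : nat}.
Implicit Types (w v : 'rV[R]_n * R -> R) (p : 'rV[R]_n * R) (i j : 'I_n).

Local Notation e_ i := (delta_mx 0 i : 'rV[R]_n).

(** Only times before that of p are involved, as suits a parabolic equation; m
    bounds the time derivative and 2 q i the second derivative along the i-th
    axis.  First-order coefficients in space are discarded, since the equation
    does not involve the gradient. *)
Definition upper_jet w p (m : R) (q : 'I_n -> R) : Prop :=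
  exists (C r : R) (l : 'I_n -> R), [/\ 0 < r,
    forall h, 0 <= h <= r -> w (p.1, p.2 - h) <= w p - m * h + C * h ^+ 2 &
    forall i h, `|h| <= r ->
      w (p.1 + h *: e_ i, p.2) <= w p + l i * h + q i * h ^+ 2].

Definition subsolution (k : R) (F : R -> R) v : Prop :=
  forall p m q, 0 < p.2 -> upper_jet v p m q ->
    m - 2 * k * \sum_(i < n) q i <= F (v p).

Definition supersolution (k : R) (F : R -> R) w : Prop :=
  forall p, 0 < p.2 -> exists m q, upper_jet w p m q /\
    F (w p) <= m - 2 * k * \sum_(i < n) q i.

Lemma upper_jetD w v p m m' q q' :
  upper_jet w p m q -> upper_jet v p m' q' ->
  upper_jet (fun p => w p + v p) p (m + m') (fun i => q i + q' i).
Proof.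
move=> [C [r [l [r0 wt wx]]]] [C' [r' [l' [r0' vt vx]]]].
exists (C + C'), (Num.min r r'), (fun i => l i + l' i); split.
- by rewrite lt_min r0.
- move=> h; rewrite le_min => /andP[h0 /andP[hr hr']].
  by have := wt h; have := vt h; rewrite h0 hr hr' => /(_ isT) + /(_ isT); lra.
- move=> i h; rewrite le_min => /andP[hr hr'].
  by have := wx i h hr; have := vx i h hr'; lra.
Qed.

Lemma upper_jetZ w p m q a : 0 <= a -> upper_jet w p m q ->
  upper_jet (fun p => a * w p) p (a * m) (fun i => a * q i).
Proof.
move=> a0 [C [r [l [r0 wt wx]]]]; exists (a * C), r, (fun i => a * l i); split=> //.
- by move=> h /wt /(ler_wpM2l a0) /le_trans; apply; rewrite le_eqVlt; apply/orP; left; apply/eqP; ring.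
- by move=> i h /wx /(ler_wpM2l a0) /le_trans; apply; rewrite le_eqVlt; apply/orP; left; apply/eqP; ring.
Qed.

(** The form in which a maximum is exploited: a function that touches w from
    below at p, in the past of p, inherits the jets of w. *)
Lemma upper_jet_touch w v p T m q : T < p.2 -> v p = w p ->
  (forall x s, T <= s <= p.2 -> v (x, s) <= w (x, s)) ->
  upper_jet w p m q -> upper_jet v p m q.
Proof.
move=> Tp vw vlew [C [r [l [r0 wt wx]]]].
exists C, (Num.min r (p.2 - T)), l; split.
- by rewrite lt_min r0 subr_gt0.
- move=> h; rewrite le_min => /andP[h0 /andP[hr hT]].
  rewrite vw; apply: le_trans (wt _ _); last by rewrite h0.
  by apply: vlew; lra.
- move=> i h; rewrite le_min => /andP[hr _].
  rewrite vw; apply: le_trans (wx _ _ hr); apply: vlew.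
  by rewrite lexx ltW.
Qed.

Lemma classical_subsolution (k : R) (F : R -> R) v : 0 <= k ->
  (forall p, 0 < p.2 ->
    [/\ derivable (fun s : R => v (p.1, s)) p.2 1,
        forall i, derivable (fun y : 'rV[R]_n => v (y, p.2)) p.1 (e_ i)
      & forall i, derivable (fun y : 'rV[R]_n => dx i v (y, p.2)) p.1 (e_ i)]) ->
  (forall p, 0 < p.2 -> dt v p - k * laplacian v p <= F (v p)) ->
  subsolution k F v.
Proof.
move=> k0 dv vF p m q p0 [C [r [l [r0 vt vx]]]].
apply: le_trans (vF p p0); have [dvt _ _] := dv p p0.
have mdt : m <= dt v p.
  have /derivableP vt' := dvt.
  rewrite /dt derive1E; apply: (derivative_left_expansion_ge vt' r0 (C := C)) => h hr.
  by apply: le_trans (vt h hr) _; case: (p).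
have qdx i : dx i (dx i v) p <= 2 * q i.
  pose f (h : R) := v (p.1 + h *: e_ i, p.2).
  pose f' (h : R) := dx i v (p.1 + h *: e_ i, p.2).
  have ff' (h : R) : is_derive h 1 f (f' h).
    have [_ + _] := dv (p.1 + h *: e_ i, p.2) p0.
    by move=> /(_ i); exact: is_derive_along.
  have f'd : is_derive (0 : R) 1 f' (dx i (dx i v) p).
    have [_ _ /(_ i)] := dv p p0.
    have pE : p.1 = p.1 + 0 *: e_ i by rewrite scale0r addr0.
    by rewrite {1}pE => /is_derive_along; rewrite -pE.
  apply: (second_derivative_le ff' f'd r0 (l := l i)) => h hr.
  by rewrite /f scale0r addr0; have := vx i h hr; case: (p).
rewrite lerB// -mulrA mulrCA ler_wpM2l// mulr_sumr; exact: ler_sum.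
Qed.

End Viscosity.

(** * The Tychonoff weight *)

(** From expR (- z) >= 1 - z, since (1 - z) (1 + z + 2 z^2) >= 1 when
    z <= 1 / 2. *)
Lemma expR_le_quadratic (R : realType) (z : R) : z <= 1 / 2 ->
  expR z <= 1 + z + 2 * z ^+ 2.
Proof.
move=> z2; rewrite -[expR z]invrK -expRN.
have z1 : 0 < 1 - z by lra.
apply: (@le_trans _ _ (1 - z)^-1).
  by rewrite lef_pV2 ?posrE ?expR_gt0//; have := expR_ge1Dx (- z); lra.
have : 0 <= z ^+ 2 * (1 - 2 * z) by rewrite mulr_ge0 ?sqr_ge0//; lra.
by rewrite -[(1 - z)^-1]mul1r ler_pdivrMr//; lra.
Qed.

Section Euclid.
Context {R : realType} {n : nat}.
Implicit Types (x : 'rV[R]_n) (i : 'I_n).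
Local Notation e_ i := (delta_mx 0 i : 'rV[R]_n).

Definition sqn x : R := \sum_(i < n) x 0 i ^+ 2.

Lemma sqn_ge0 x : 0 <= sqn x.
Proof. by apply: sumr_ge0 => i _; exact: sqr_ge0. Qed.

Lemma sqnD_delta x i h : sqn (x + h *: e_ i) = sqn x + 2 * x 0 i * h + h ^+ 2.
Proof.
rewrite /sqn (bigD1 i)//= [in RHS](bigD1 i)//= !mxE !eqxx mulr1.
rewrite (eq_bigr (fun j => x 0 j ^+ 2)); first by ring.
by move=> j ji; rewrite !mxE (negbTE ji) andbF mulr0 addr0.
Qed.

Lemma coord_le_norm x i : `|x 0 i| <= `|x|.
Proof.
rewrite [leRHS]/Num.norm /= mx_normrE; apply/bigmax_geP; right => /=.
by exists (0, i).
Qed.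

Lemma sqr_norm_le_sqn x : `|x| ^+ 2 <= sqn x.
Proof.
have [->|x0] := eqVneq x 0; first by rewrite normr0 expr0n/= sqn_ge0.
have [[j i] xE] : exists k : 'I_1 * 'I_n, `|x| = `|x k.1 k.2|.
  by apply: mx_norm_neq0; rewrite -[mx_norm x]/(`|x|) normr_eq0.
rewrite xE/= (ord1 j) real_normK ?num_real// /sqn (bigD1 i)//= lerDl.
by apply: sumr_ge0 => k _; exact: sqr_ge0.
Qed.

Lemma sqn_continuous : continuous sqn.
Proof.
rewrite (_ : sqn = \sum_(i < n) (fun x : 'rV[R]_n => x 0 i ^+ 2)); last first.
  by apply/funext => x; rewrite /sqn fct_sumE.
elim/big_ind: _ => [|f g cf cg x|i _ x]; first exact: cst_continuous.
  exact: (continuousD (cf x) (cg x)).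
have ci : {for x, continuous (fun y : 'rV[R]_n => y 0 i)} by exact: coord_continuous.
exact: (continuousM ci ci).
Qed.

End Euclid.

Section Penalty.
Context {R : realType} {n : nat}.
Implicit Types (p : 'rV[R]_n * R).

(** The exact Tychonoff weight is a Gaussian of negative variance; with an
    exponent affine in time it stays a supersolution of the heat equation on a
    short time interval, which suffices. *)
Definition penalty (T0 k0 b0 b1 : R) p : R :=
  expR (k0 * (p.2 - T0) + (b0 + b1 * (p.2 - T0)) * sqn p.1).

(** The exact half second derivative along the i-th axis is b + 2 b^2 x_i^2 times
    the weight; the larger coefficient taken here leaves room for the remainder
    of the expansion and only shortens the time interval of comparison. *)
Lemma penalty_jet (T0 k0 b0 b1 : R) p (b := b0 + b1 * (p.2 - T0)) :
  0 <= k0 -> 0 <= b1 -> 0 <= b ->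
  upper_jet (penalty T0 k0 b0 b1) p
    ((k0 + b1 * sqn p.1) * penalty T0 k0 b0 b1 p)
    (fun i => (2 * b + 16 * b ^+ 2 * p.1 0 i ^+ 2) * penalty T0 k0 b0 b1 p).
Proof.
move=> k00 b10 bge0; set H := penalty T0 k0 b0 b1 p.
have H0 : 0 < H by rewrite /H /penalty expR_gt0.
set mu := k0 + b1 * sqn p.1.
have mu0 : 0 <= mu by rewrite addr_ge0// mulr_ge0// sqn_ge0.
set X := `|p.1|; have X0 : 0 <= X := normr_ge0 _.
(* Small enough for b (2 x_i h + h^2) <= 1 / 2 and 4 b h^2 <= 1 along every
   axis i when |h| <= r. *)
pose r := (4 * (b + 1) * (X + 1))^-1.
have bX : 0 < 4 * (b + 1) * (X + 1) by rewrite !mulr_gt0//; lra.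
have r0 : 0 < r by rewrite invr_gt0.
have rE : r * (4 * (b + 1) * (X + 1)) = 1 by rewrite mulVf// gt_eqF.
have step z : z <= 1 / 2 -> H * expR z <= H * (1 + z + 2 * z ^+ 2).
  by move=> z2; rewrite ler_pM2l// expR_le_quadratic.
exists (2 * mu ^+ 2 * H), r, (fun i => 2 * b * p.1 0 i * H); split=> //.
- move=> h /andP[h0 _].
  have -> : penalty T0 k0 b0 b1 (p.1, p.2 - h) = H * expR (- (mu * h)).
    by rewrite /H /penalty -expRD /mu /=; congr expR; ring.
  apply: (le_trans (step _ _)); first by have := mulr_ge0 mu0 h0; lra.
  by rewrite -/H le_eqVlt; apply/orP; left; apply/eqP; ring.
- move=> i h hr; set xi := p.1 0 i.
  have xiX : `|xi| <= X by exact: coord_le_norm.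
  have -> : penalty T0 k0 b0 b1 (p.1 + h *: delta_mx 0 i, p.2) =
      H * expR (b * (2 * xi * h + h ^+ 2)).
    by rewrite /H /penalty -expRD /b /= sqnD_delta; congr expR; rewrite -/xi; ring.
  have rX : r * X >= 0 by rewrite mulr_ge0// ltW.
  have rb : r * b >= 0 by rewrite mulr_ge0// ltW.
  have rbX : r * b * X >= 0 by rewrite mulr_ge0.
  have r4 : r <= 1 / 4 by lra.
  have xh : xi * h <= X * r.
    by apply: le_trans (ler_norm _) _; rewrite normrM; apply: ler_pM.
  have hh : h ^+ 2 <= r * (1 / 4).
    rewrite -(real_normK (num_real h)) expr2; apply: ler_pM => //.
    exact: le_trans hr r4.
  have z2 : b * (2 * xi * h + h ^+ 2) <= 1 / 2.
    by have := ler_wpM2l bge0 xh; have := ler_wpM2l bge0 hh; lra.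
  apply: (le_trans (step _ z2)).
  have bh : 4 * b ^+ 2 * h ^+ 2 <= b.
    have := ler_wpM2l bge0 (ler_wpM2l bge0 hh).
    have : b * (r * b) <= b * (1 / 4) by rewrite ler_wpM2l//; lra.
    by lra.
  have sq : 2 * (b * (2 * xi * h + h ^+ 2)) ^+ 2 <=
      (16 * b ^+ 2 * xi ^+ 2 + b) * h ^+ 2.
    have := ler_wpM2r (sqr_ge0 h) bh.
    have : 0 <= b ^+ 2 * h ^+ 2 * (2 * xi - h) ^+ 2.
      by apply: mulr_ge0 (sqr_ge0 _); apply: mulr_ge0; exact: sqr_ge0.
    by nra.
  have : H * (1 + b * (2 * xi * h + h ^+ 2) + 2 * (b * (2 * xi * h + h ^+ 2)) ^+ 2) <=
         H * (1 + b * (2 * xi * h + h ^+ 2) + (16 * b ^+ 2 * xi ^+ 2 + b) * h ^+ 2).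
    by rewrite ler_pM2l// lerD2l.
  move=> /le_trans; apply.
  by rewrite -/H le_eqVlt; apply/orP; left; apply/eqP; ring.
Qed.

Lemma penalty_continuous (T0 k0 b0 b1 : R) : continuous (penalty T0 k0 b0 b1).
Proof.
move=> p; apply: continuous_comp; last exact: continuous_expR.
apply: cvgD.
  by apply: cvgM; [exact: cvg_cst|apply: cvgB; [exact: cvg_snd|exact: cvg_cst]].
apply: cvgM; last first.
  by apply: continuous_comp; [exact: cvg_fst|exact: sqn_continuous].
apply: cvgD; first exact: cvg_cst.
by apply: cvgM; [exact: cvg_cst|apply: cvgB; [exact: cvg_snd|exact: cvg_cst]].
Qed.

End Penalty.

(** * Comparison principle *)

Section Comparison.
Context {R : realType} {n : nat}.
Implicit Types (v w : 'rV[R]_n * R -> R).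
Variables (k : R) (F : R -> R) (lam : R).
Hypotheses (k0 : 0 < k) (lam0 : 0 <= lam).
Hypothesis F_lip : forall x y, `|F x - F y| <= lam * `|x - y|.

(** Let M be the maximum of (v - w) / H, assumed positive.  It is attained, as H
    beats the growth of v - w, and v then touches w + M H from below.  The jets
    give k1 M H <= lam M H up to terms that b1 and k1 are chosen to absorb, and
    k1 exceeds lam by more than these: a contradiction.  Dividing by H rather
    than subtracting a small multiple of it is what controls the zeroth-order
    term, since then v - w is exactly M H at the maximum. *)
Lemma comparison_step v w (a C T0 T : R) : 0 <= a -> 0 <= C -> 0 <= T0 ->
  T <= T0 + (128 * k * (a + 1))^-1 ->
  {within [set p | 0 <= p.2], continuous v} ->
  {within [set p | 0 <= p.2], continuous w} ->
  subsolution k F v -> supersolution k F w ->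
  (forall p : 'rV[R]_n * R, 0 <= p.2 <= T -> v p - w p <= C * expR (a * `|p.1| ^+ 2)) ->
  (forall x, v (x, T0) <= w (x, T0)) ->
  forall x t, T0 <= t <= T -> v (x, t) <= w (x, t).
Proof.
move=> a0 C0 T00 TT0 cv cw vsub wsup growth init x1 t1 /andP[T0t1 t1T].
rewrite leNgt; apply/negP => vw1.
(* b0 > a makes H dominate v - w; b1 makes the time derivative of the exponent
   absorb 32 k b^2 |x|^2 as long as b <= 2 b0, that is for a time b0 / b1. *)
pose b0 := a + 1; pose b1 := 128 * k * b0 ^+ 2.
pose k1 := lam + 8 * k * b0 * n%:R + 1.
have b00 : 0 < b0 by rewrite /b0; lra.
have n0 : 0 <= n%:R :> R by [].
have b10 : 0 < b1 by rewrite /b1 !mulr_gt0// exprn_gt0.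
have k10 : 0 <= k1 by rewrite /k1 !addr_ge0// !mulr_ge0// ltW.
pose H := @penalty R n T0 k1 b0 b1.
have H0 p : 0 < H p by rewrite /H /penalty expR_gt0.
pose E p := (v p - w p) / H p.
set mu := E (x1, t1).
have mu0 : 0 < mu by rewrite /mu /E divr_gt0 ?subr_gt0.
(* Outside the ball of radius rho the quotient is at most mu, because
   C exp (- |x|^2) <= C / (1 + |x|^2). *)
pose rho := `|x1| + C / mu + 1.
have rho1 : 1 <= rho by rewrite /rho lerDr addr_ge0// divr_ge0// ltW.
have Eout p : T0 <= p.2 <= t1 -> rho < `|p.1| -> E p <= mu.
  move=> /andP[lo hi] out; rewrite /E ler_pdivrMr//.
  have pT : 0 <= p.2 <= T by apply/andP; split; lra.
  apply: (le_trans (growth p pT)).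
  have : a * `|p.1| ^+ 2 + `|p.1| ^+ 2 <= k1 * (p.2 - T0) + (b0 + b1 * (p.2 - T0)) * sqn p.1.
    have S := sqr_norm_le_sqn p.1.
    have : 0 <= k1 * (p.2 - T0) by rewrite mulr_ge0// subr_ge0.
    have : 0 <= b1 * (p.2 - T0) * sqn p.1.
      by rewrite !mulr_ge0 ?sqn_ge0 ?subr_ge0// ltW.
    have : b0 * `|p.1| ^+ 2 <= b0 * sqn p.1 by rewrite ler_wpM2l// ltW.
    by rewrite /b0; lra.
  rewrite -ler_expR expRD -/(penalty T0 k1 b0 b1 p) -/(H p) => HE.
  rewrite -(ler_pM2l mu0) in HE; apply: le_trans HE.
  rewrite [leRHS]mulrCA (mulrC C); apply: ler_wpM2l; first exact: expR_ge0.
  have e1 := expR_ge1Dx (`|p.1| ^+ 2).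
  have : rho * rho <= `|p.1| ^+ 2 by rewrite expr2; apply: ler_pM; lra.
  have : rho <= rho * rho by rewrite ler_peMl//; lra.
  have : C / mu <= rho by rewrite /rho; have := normr_ge0 x1; lra.
  move=> h1 h2 h3; rewrite -ler_pdivrMl// mulrC; lra.
pose K : set ('rV[R]_n * R) :=
  [set x : 'rV[R]_n | forall i, `[- rho, rho]%classic (x ord0 i)] `*` `[T0, t1].
have cK : compact K.
  apply: compact_setX; last exact: segment_compact.
  by apply: (@rV_compact _ _ (fun=> `[- rho, rho]%classic)) => _; exact: segment_compact.
have inK x s : `|x| <= rho -> T0 <= s <= t1 -> K (x, s).
  move=> xr sI; split=> /= [i|]; rewrite in_itv/= ?sI//.
  by rewrite -ler_norml (le_trans (coord_le_norm _ _)).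
have K1 : K (x1, t1).
  apply: inK; last by rewrite T0t1 lexx.
  by rewrite /rho -addrA lerDl addr_ge0// divr_ge0// ltW.
have Kpos p : K p -> 0 <= p.2.
  by move=> [_ /=]; rewrite in_itv/= => /andP[+ _]; apply: le_trans.
have cE : {within K, continuous E}.
  have cvK := continuous_subspaceW Kpos cv.
  have cwK := continuous_subspaceW Kpos cw.
  have cH : {within K, continuous H}.
    by apply: continuous_subspaceT; exact: penalty_continuous.
  move=> p; apply: cvgM; first by apply: cvgB; [exact: cvK|exact: cwK].
  by apply: cvgV; [rewrite gt_eqF|exact: cH].
have [p0 /set_mem Kp0 p0max] := compact_EVT_max (ex_intro _ _ K1) cK cE.
have Emax p : T0 <= p.2 <= t1 -> E p <= E p0.
  move=> pI; have [pr|pr] := leP `|p.1| rho.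
    by apply: p0max; apply/mem_set; rewrite (surjective_pairing p); exact: inK.
  by apply: le_trans (Eout _ pI pr) _; apply: p0max; exact/mem_set.
set M := E p0.
have M0 : 0 < M.
  by apply: lt_le_trans mu0 _; apply: Emax; rewrite /= T0t1 lexx.
have /andP[p0lo p0hi] : T0 <= p0.2 <= t1.
  by case: Kp0 => _ /=; rewrite in_itv.
have T0p0 : T0 < p0.2.
  rewrite lt_neqAle p0lo andbT; apply/eqP => T0E.
  have := M0; rewrite /M /E (surjective_pairing p0) -T0E pmulr_lgt0 ?invr_gt0//.
  by have := init p0.1; lra.
have p0pos : 0 < p0.2 by lra.
have touch : v p0 = w p0 + M * H p0 by rewrite /M /E divfK ?gt_eqF//; lra.
have vle x s : T0 <= s <= p0.2 -> v (x, s) <= w (x, s) + M * H (x, s).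
  move=> /andP[lo hi]; have := Emax (x, s); rewrite /= lo (le_trans hi)// => /(_ isT).
  by rewrite -/M /E ler_pdivrMr//; lra.
have [m [q [wjet wF]]] := wsup p0 p0pos.
pose b := b0 + b1 * (p0.2 - T0).
have b_ge0 : 0 <= b by rewrite /b addr_ge0 ?mulr_ge0 ?subr_ge0// ltW.
have bb0 : b <= 2 * b0.
  have : b1 * (p0.2 - T0) <= b1 * (128 * k * (a + 1))^-1.
    by rewrite ler_wpM2l ?(ltW b10)//; lra.
  have -> : b1 * (128 * k * (a + 1))^-1 = b0.
    by rewrite /b1 -/b0; field; rewrite !gt_eqF.
  by rewrite /b; lra.
have Hjet := @penalty_jet R n T0 k1 b0 b1 p0 k10 (ltW b10) b_ge0.
have vjet := upper_jet_touch T0p0 touch vle (upper_jetD wjet (upper_jetZ (ltW M0) Hjet)).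
have := vsub p0 _ _ p0pos vjet.
rewrite big_split/= -/(H p0) -/b -mulr_sumr -mulr_suml big_split/= sumr_const card_ord -mulr_sumr -/(sqn p0.1).
set S := sqn p0.1; have S0 : 0 <= S by exact: sqn_ge0.
have := F_lip (v p0) (w p0).
have -> : v p0 - w p0 = M * H p0 by rewrite touch; lra.
have MH : 0 < M * H p0 by exact: mulr_gt0.
rewrite (gtr0_norm MH) ler_norml => /andP[_ Fvw] sub.
have key : k1 + b1 * S - 2 * k * (2 * b *+ n + 16 * b ^+ 2 * S) <= lam.
  rewrite -(ler_pM2r MH).
  have -> : (k1 + b1 * S - 2 * k * (2 * b *+ n + 16 * b ^+ 2 * S)) * (M * H p0) =
     m + M * ((k1 + b1 * S) * H p0) - 2 * k * (\sum_(i < n) q i +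
       M * ((2 * b *+ n + 16 * b ^+ 2 * S) * H p0)) - (m - 2 * k * \sum_(i < n) q i).
    by ring.
  by lra.
(* The excess k1 - lam - 8 k b0 n = 1 contradicts [key]. *)
have kb : k * b * n%:R <= k * (2 * b0) * n%:R.
  by rewrite ler_wpM2r// ler_wpM2l// ltW.
have kbS : k * b ^+ 2 * S <= k * (2 * b0) ^+ 2 * S.
  rewrite ler_wpM2r// ler_wpM2l ?(ltW k0)// ler_sqr ?nnegrE//.
  by rewrite mulr_ge0// ltW.
by move: key; rewrite -(mulr_natr (2 * b)) /k1 /b1; lra.
Qed.

End Comparison.

(** The length of the time steps depends only on k and on the growth rate a. *)
Lemma comparison (R : realType) (n : nat) (k : R) (F : R -> R) (lam : R)
    (v w : 'rV[R]_n * R -> R) (a C T : R) :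
  0 < k -> 0 <= lam -> (forall x y, `|F x - F y| <= lam * `|x - y|) ->
  0 <= a -> 0 <= C ->
  {within [set p | 0 <= p.2], continuous v} ->
  {within [set p | 0 <= p.2], continuous w} ->
  subsolution k F v -> supersolution k F w ->
  (forall p : 'rV[R]_n * R, 0 <= p.2 <= T ->
    v p - w p <= C * expR (a * `|p.1| ^+ 2)) ->
  (forall x, v (x, 0) <= w (x, 0)) ->
  forall x t, 0 <= t <= T -> v (x, t) <= w (x, t).
Proof.
move=> k0 lam0 Flip a0 C0 cv cw vsub wsup growth init.
pose tau := (128 * k * (a + 1))^-1.
have tau0 : 0 < tau by rewrite invr_gt0 !mulr_gt0//; lra.
have steps (N : nat) x t : 0 <= t <= T -> t <= N%:R * tau -> v (x, t) <= w (x, t).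
  elim: N x t => [|N IH] x t tI.
    by rewrite mul0r => t0; have -> : t = 0 by lra.
  have [tN _|Nt tN] := leP t (N%:R * tau); first exact: IH.
  have N0 : 0 <= N%:R * tau by rewrite mulr_ge0// ltW.
  apply: (@comparison_step _ _ _ _ _ k0 lam0 Flip v w a C (N%:R * tau) t) => //.
  - by rewrite -/tau; move: tN; rewrite -natr1; lra.
  - by move=> p pt; apply: growth; lra.
  - by move=> y; apply: IH => //; lra.
  - by rewrite ltW// lexx.
move=> x t tI; apply: (steps (Num.bound (T / tau))) => //.
have /archi_boundP : 0 <= T / tau by rewrite divr_ge0 ?(ltW tau0)//; lra.
by rewrite ltr_pdivrMr//; lra.
Qed.

(** * Barriers built from smoothed cones *)

Section SqrtBarrier.
Context {R : realType}.
Implicit Types (A d z h : R).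

Lemma sqrtrD_le_tangent A d : 0 < A -> 0 <= A + d ->
  Num.sqrt (A + d) <= Num.sqrt A + d / (2 * Num.sqrt A).
Proof.
move=> A0 Ad0; have sA : 0 < Num.sqrt A by rewrite sqrtr_gt0.
have dE : d = Num.sqrt (A + d) ^+ 2 - Num.sqrt A ^+ 2.
  by rewrite !sqr_sqrtr// ?ltW//; ring.
rewrite -lerBlDl ler_pdivlMr ?mulr_gt0//; rewrite {2}dE.
have := sqr_ge0 (Num.sqrt (A + d) - Num.sqrt A); lra.
Qed.

Lemma sqrtr_shift_dist A z h : z ^+ 2 <= A ->
  `|Num.sqrt (A + 2 * z * h + h ^+ 2) - Num.sqrt A| <= `|h|.
Proof.
have half A' z' h' : z' ^+ 2 <= A' ->
    Num.sqrt (A' + 2 * z' * h' + h' ^+ 2) <= Num.sqrt A' + `|h'|.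
  move=> zA; have A0 : 0 <= A' by apply: le_trans zA; exact: sqr_ge0.
  have s0 : 0 <= Num.sqrt A' + `|h'| by rewrite addr_ge0// sqrtr_ge0.
  have zs : z' * h' <= Num.sqrt A' * `|h'|.
    apply: le_trans (ler_norm _) _; rewrite normrM ler_wpM2r//.
    by rewrite -sqrtr_sqr ler_wsqrtr.
  rewrite -[leRHS]ger0_norm// -sqrtr_sqr ler_wsqrtr// sqrrD sqr_sqrtr//.
  by rewrite real_normK ?num_real//; lra.
move=> zA; rewrite ler_norml lerBlDl half// andbT.
have zA' : (z + h) ^+ 2 <= A + 2 * z * h + h ^+ 2 by lra.
have := half _ _ (- h) zA'; rewrite normrN.
by rewrite (_ : A + 2 * z * h + h ^+ 2 + 2 * (z + h) * - h + (- h) ^+ 2 = A); [lra|ring].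
Qed.

End SqrtBarrier.

Section Barrier.
Context {R : realType} {n : nat}.
Variables (G Psi : R -> R) (a b B K : R).
Hypothesis PsiP : corrector G Psi a b B K.
Variables (eps : R) (x0 : 'rV[R]_n) (A L eta m : R).
Hypotheses (eps0 : 0 < eps) (L0 : 0 <= L) (eta0 : 0 < eta).

(** A smoothed cone with vertex x0: second derivatives of order 1 / eta, slope at
    most 1, height eta at the vertex. *)
Definition cone (x : 'rV[R]_n) : R := Num.sqrt (eta ^+ 2 + sqn (x - x0)).

Definition barrier (p : 'rV[R]_n * R) : R :=
  eps * Psi ((A + L * cone p.1 + m * p.2) / eps).

Lemma barrier_dist p : `|barrier p - (A + L * cone p.1 + m * p.2)| <= B * eps.
Proof.
have [_ PsiB _ _] := PsiP; rewrite /barrier; set phi := (X in X / eps).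
have -> : eps * Psi (phi / eps) - phi = (Psi (phi / eps) - phi / eps) * eps.
  by field; rewrite gt_eqF.
by rewrite normrM (gtr0_norm eps0) ler_pM2r.
Qed.

Lemma cone_ge_eta x : eta <= cone x.
Proof.
rewrite -[leLHS]gtr0_norm// -sqrtr_sqr ler_wsqrtr// lerDl; exact: sqn_ge0.
Qed.

Lemma cone_ge_norm x : `|x - x0| <= cone x.
Proof.
rewrite -[leLHS]normr_id -sqrtr_sqr ler_wsqrtr//.
by have := sqr_norm_le_sqn (x - x0); have := sqr_ge0 eta; lra.
Qed.

Lemma cone_center : cone x0 = eta.
Proof.
rewrite /cone subrr (_ : sqn 0 = 0) ?addr0; last first.
  by rewrite /sqn big1// => i _; rewrite mxE expr0n.
by rewrite sqrtr_sqr gtr0_norm.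
Qed.

Lemma cone_continuous : continuous cone.
Proof.
move=> x.
have cS : {for x, continuous (fun y : 'rV[R]_n => eta ^+ 2 + sqn (y - x0))}.
  apply: continuousD; first exact: cst_continuous.
  apply: (@continuous_comp _ _ _ (fun y : 'rV[R]_n => y - x0) sqn); last exact: sqn_continuous.
  by apply: continuousB; [exact: cvg_id|exact: cst_continuous].
exact: (continuous_comp cS (@sqrt_continuous R _)).
Qed.

Lemma barrier_continuous : continuous barrier.
Proof.
have [_ _ Psib _] := PsiP.
have cPsi : continuous Psi.
  by apply: (@modulus_continuous R R R _ b) => x y; have := Psib y (x - y); rewrite (addrC y) subrK.
move=> p; apply: continuousM; first exact: cst_continuous.
apply: continuous_comp; last exact: cPsi.
apply: continuousM; last exact: cst_continuous.
apply: continuousD; last first.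
  by apply: continuousM; [exact: cst_continuous|exact: cvg_snd].
apply: continuousD; first exact: cst_continuous.
apply: continuousM; first exact: cst_continuous.
by apply: continuous_comp; [exact: cvg_fst|exact: cone_continuous].
Qed.

(** Moving along an axis changes the argument of Psi by an amount bounded above
    by a quadratic polynomial, by concavity of the square root, and in absolute
    value by the displacement; the expansion of Psi turns this into a jet.  The
    term K L^2 / eps is the contribution of the gradient squared. *)
Lemma barrier_jet p (s := (A + L * cone p.1 + m * p.2) / eps) :
  upper_jet barrier p (G (Psi s) * m)
    (fun=> G (Psi s) * L / (2 * cone p.1) + K * L ^+ 2 / eps).
Proof.
have [[a0 Gab] _ _ PsiK] := PsiP.
have D0 : 0 <= G (Psi s) by have := Gab (Psi s); lra.
have K0 := corrector_K_ge0 PsiP.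
have c0 : 0 < cone p.1 by apply: lt_le_trans (cone_ge_eta _).
have step d : eps * Psi (s + d / eps) <=
    barrier p + G (Psi s) * d + K / eps * d ^+ 2.
  have := PsiK s (d / eps); rewrite ler_norml => /andP[_].
  rewrite -(ler_pM2l eps0) -/s.
  have -> : eps * (K * (d / eps) ^+ 2) = K / eps * d ^+ 2.
    by field; rewrite gt_eqF.
  have -> : eps * (Psi (s + d / eps) - Psi s - G (Psi s) * (d / eps)) =
      eps * Psi (s + d / eps) - barrier p - G (Psi s) * d.
    by rewrite /barrier -/s; field; rewrite gt_eqF.
  by lra.
exists (K / eps * m ^+ 2), 1, (fun i => G (Psi s) * L * (p.1 - x0) 0 i / cone p.1).
split=> // [h _|i h _].
- have := step (- (m * h)).
  have -> : eps * Psi (s + - (m * h) / eps) = barrier (p.1, p.2 - h).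
    by rewrite /barrier /s /=; congr (_ * Psi _); field; rewrite gt_eqF.
  by move=> /le_trans; apply; rewrite le_eqVlt; apply/orP; left; apply/eqP; ring.
- set y := (p.1 - x0) 0 i; set S := eta ^+ 2 + sqn (p.1 - x0).
  have S0 : 0 < S by rewrite -sqrtr_gt0.
  have coneE : cone (p.1 + h *: delta_mx 0 i) = Num.sqrt (S + 2 * y * h + h ^+ 2).
    by rewrite /cone addrAC sqnD_delta -/y !addrA.
  have yS : y ^+ 2 <= S.
    have : y ^+ 2 <= sqn (p.1 - x0).
      by rewrite /sqn (bigD1 i)//= lerDl; apply: sumr_ge0 => j _; exact: sqr_ge0.
    by rewrite /S; have := sqr_ge0 eta; lra.
  pose d := L * (cone (p.1 + h *: delta_mx 0 i) - cone p.1).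
  have := step d.
  have -> : eps * Psi (s + d / eps) = barrier (p.1 + h *: delta_mx 0 i, p.2).
    by rewrite /barrier /s /d /=; congr (_ * Psi _); field; rewrite gt_eqF.
  move=> /le_trans; apply.
  have d1 : d <= L * ((2 * y * h + h ^+ 2) / (2 * cone p.1)).
    rewrite /d coneE ler_wpM2l// lerBlDl -addrA; apply: sqrtrD_le_tangent => //.
    by have := sqr_ge0 (y + h); lra.
  have d2 : d ^+ 2 <= L ^+ 2 * h ^+ 2.
    rewrite /d exprMn ler_wpM2l ?sqr_ge0//.
    rewrite -(real_normK (num_real h)) -[X in X <= _]real_normK ?num_real//.
    by rewrite ler_sqr ?nnegrE// coneE; exact: sqrtr_shift_dist.
  have Ke : 0 <= K / eps by rewrite divr_ge0// ltW.
  have e1 := ler_wpM2l D0 d1; have e2 := ler_wpM2l Ke d2.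
  have -> : barrier p + G (Psi s) * L * y / cone p.1 * h +
      (G (Psi s) * L / (2 * cone p.1) + K * L ^+ 2 / eps) * h ^+ 2 =
    barrier p + G (Psi s) * (L * ((2 * y * h + h ^+ 2) / (2 * cone p.1))) +
      K / eps * (L ^+ 2 * h ^+ 2).
    by field; rewrite !gt_eqF.
  by lra.
Qed.

(** With D = Psi' the requirement is
    c D <= D m - (cone term) D - (gradient term), and the lower bound a <= D
    allows to divide the gradient term by D. *)
Lemma barrier_supersolution (k c : R) : 0 <= k ->
  c + k * n%:R * L / eta + 2 * k * n%:R * K * L ^+ 2 / (eps * a) <= m ->
  supersolution k (fun y => c * G (y / eps)) barrier.
Proof.
move=> k0 cm p _.
have [[a0 Gab] _ _ PsiK] := PsiP.
have K0 := corrector_K_ge0 PsiP.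
have jet := barrier_jet p; set s := (A + L * cone p.1 + m * p.2) / eps in jet.
eexists; eexists; split; first exact: jet.
rewrite sumr_const card_ord -(mulr_natl _ n).
have -> : barrier p / eps = Psi s by rewrite /barrier -/s mulrAC divff ?mul1r// gt_eqF.
set D := G (Psi s); have aD : a <= D by case/andP: (Gab (Psi s)).
have D0 : 0 < D by lra.
have ce := cone_ge_eta p.1; have cp : 0 < cone p.1 by exact: lt_le_trans ce.
have t1 : k * n%:R * L / cone p.1 <= k * n%:R * L / eta.
  by rewrite ler_wpM2l ?mulr_ge0// lef_pV2.
have t2 : 2 * k * n%:R * K * L ^+ 2 / eps <= D * (2 * k * n%:R * K * L ^+ 2 / (eps * a)).
  set N := 2 * k * n%:R * K * L ^+ 2.
  have N0 : 0 <= N / eps by rewrite divr_ge0 ?(ltW eps0)// !mulr_ge0.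
  have -> : D * (N / (eps * a)) = N / eps * (D / a) by field; rewrite !gt_eqF.
  by rewrite ler_peMr// ler_pdivlMr// mul1r.
have := ler_wpM2l (ltW D0) cm; have := ler_wpM2l (ltW D0) t1.
have -> : D * m - 2 * k * (n%:R * (D * L / (2 * cone p.1) + K * L ^+ 2 / eps)) =
    D * m - D * (k * n%:R * L / cone p.1) - 2 * k * n%:R * K * L ^+ 2 / eps.
  by field; rewrite !gt_eqF.
by lra.
Qed.

End Barrier.

(** * Homogenization estimate *)

Section OneSided.
Context {R : realType} {n : nat}.
Variables (G Psi : R -> R) (a b B K : R).
Hypothesis PsiP : corrector G Psi a b B K.

(** With k = eps^alpha the gradient term is of order k / eps = eps^(alpha-1);
    this is where alpha > 1 is used. *)
Definition homogenization_error (eps k L eta T : R) : R :=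
  2 * (B * eps) + L * eta +
  T * (k * n%:R * L / eta + 2 * k * n%:R * K * L ^+ 2 / (eps * a)).

(** Comparison with the barrier centred at x0, lifted by B eps so that it lies
    above v at time 0 in spite of the bounded gap between Psi and the
    identity. *)
Lemma subsolution_le (k eps c L lam eta T : R) (v : 'rV[R]_n * R -> R) :
  0 < k -> 0 < eps -> 0 <= L -> 0 <= lam -> 0 < eta ->
  (forall x y, `|c * G (x / eps) - c * G (y / eps)| <= lam * `|x - y|) ->
  {within [set p | 0 <= p.2], continuous v} ->
  subsolution k (fun y => c * G (y / eps)) v ->
  tychonoff_growth v ->
  (forall x y, `|v (x, 0) - v (y, 0)| <= L * `|x - y|) ->
  forall x t, 0 <= t <= T ->
    v (x, t) <= v (x, 0) + c * t + homogenization_error eps k L eta T.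
Proof.
move=> k0 eps0 L0 lam0 eta0 Flip cv vsub vgrowth vlip x0 t /andP[t0 tT].
have [[a0 Gab] PsiB _ PsiK] := PsiP.
have K0 := corrector_K_ge0 PsiP.
have B0 : 0 <= B := le_trans (normr_ge0 _) (PsiB 0).
have Be0 : 0 <= B * eps by rewrite mulr_ge0// ltW.
pose d := k * n%:R * L / eta + 2 * k * n%:R * K * L ^+ 2 / (eps * a).
have d0 : 0 <= d.
  by rewrite addr_ge0// divr_ge0 ?(ltW eta0) ?mulr_ge0 ?(ltW k0) ?(ltW eps0) ?(ltW a0) ?sqr_ge0.
pose A := v (x0, 0) + B * eps.
pose m := c + d.
pose w := barrier Psi eps x0 A L eta m.
have wphi p : `|w p - (A + L * cone x0 eta p.1 + m * p.2)| <= B * eps.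
  exact: (barrier_dist PsiP).
have w_ge p : A + L * cone x0 eta p.1 + m * p.2 - B * eps <= w p.
  by have := wphi p; rewrite ler_norml; lra.
have wsup : supersolution k (fun y => c * G (y / eps)) w.
  apply: (barrier_supersolution PsiP) => //; first exact: ltW.
  by rewrite /m /d addrA.
have cw : {within [set p : 'rV[R]_n * R | 0 <= p.2], continuous w}.
  by apply: continuous_subspaceT; exact: (barrier_continuous PsiP).
have init x : v (x, 0) <= w (x, 0).
  apply: le_trans (w_ge _); rewrite /= /A mulr0.
  have := vlip x x0; rewrite ler_norml => /andP[_].
  by have := ler_wpM2l L0 (cone_ge_norm x0 eta x); lra.
have T0 : 0 < T + 1 by lra.
have [C [al vC]] := vgrowth _ T0.
pose W := `|C| + `|A| + `|m| * (T + 1) + B * eps.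
have growth (p : 'rV[R]_n * R) : 0 <= p.2 <= T + 1 ->
    v p - w p <= W * expR (`|al| * `|p.1| ^+ 2).
  move=> pI; have := vC p pI; rewrite ler_norml => /andP[_ vle].
  have wl := w_ge p.
  have cone0 : 0 <= L * cone x0 eta p.1 by rewrite mulr_ge0// sqrtr_ge0.
  have mp : - (`|m| * (T + 1)) <= m * p.2.
    rewrite lerNl -mulNr; apply: le_trans (ler_norm _) _.
    by rewrite normrM normrN ler_pM// ger0_norm; case/andP: pI.
  have Ae : - `|A| <= A by rewrite lerNl -normrN ler_norm.
  have E1 : 1 <= expR (`|al| * `|p.1| ^+ 2).
    by rewrite -expR0 ler_expR mulr_ge0// sqr_ge0.
  have CE : C * expR (al * `|p.1| ^+ 2) <= `|C| * expR (`|al| * `|p.1| ^+ 2).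
    apply: (@le_trans _ _ (`|C| * expR (al * `|p.1| ^+ 2))).
      by rewrite ler_wpM2r ?expR_ge0// ler_norm.
    by rewrite ler_wpM2l// ler_expR ler_wpM2r ?sqr_ge0// ler_norm.
  have rest : 0 <= `|A| + `|m| * (T + 1) + B * eps.
    by rewrite !addr_ge0// mulr_ge0// ltW.
  have := ler_wpM2l rest E1; rewrite /W; lra.
have W0 : 0 <= W by rewrite !addr_ge0// mulr_ge0// ltW.
have tT1 : 0 <= t <= T + 1 by lra.
have vw := comparison k0 lam0 Flip (normr_ge0 al) W0 cv cw vsub wsup growth init x0 tT1.
apply: (le_trans vw); have := wphi (x0, t); rewrite ler_norml /= cone_center// => /andP[_].
have : d * t <= T * d by rewrite mulrC ler_wpM2r.
by rewrite /homogenization_error -/d /A /m; lra.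
Qed.

End OneSided.

Section Classical.
Context {R : realType} {n : nat}.
Variables (g : R -> R) (u0 : 'rV[R]_n -> R) (alpha eps : R) (u : 'rV[R]_n * R -> R).
Hypothesis u_sol : classical_solution g u0 alpha eps u.

Lemma classical_solution_derivable p : 0 < p.2 ->
  [/\ derivable (fun s : R => u (p.1, s)) p.2 1,
      forall i, derivable (fun y : 'rV[R]_n => u (y, p.2)) p.1 (delta_mx 0 i)
    & forall i, derivable (fun y : 'rV[R]_n => dx i u (y, p.2)) p.1 (delta_mx 0 i)].
Proof.
move=> p0; have [_ uC2 _ _ _] := u_sol.
have half : 0 < (1 / 2 : R) < 1 by apply/andP; split; lra.
by have [/(_ p p0)[] ] := uC2 _ half; split.
Qed.

Lemma classical_solution_subsolution :
  subsolution (eps `^ alpha) (fun y => g (y / eps)) u.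
Proof.
apply: classical_subsolution; [exact: powR_ge0|exact: classical_solution_derivable|].
by move=> p p0; have [_ _ /(_ p p0) + _ _] := u_sol; lra.
Qed.

(** Applied to - u, the upper bound for subsolutions becomes the lower bound for
    u. *)
Lemma classical_solution_opp_subsolution :
  subsolution (eps `^ alpha) (fun y => - g (- y / eps)) (fun p => - u p).
Proof.
have dxN i p : 0 < p.2 -> dx i (fun p => - u p) p = - dx i u p.
  by move=> p0; have [_ /(_ i) dxu _] := classical_solution_derivable p0; exact: deriveN.
have dxxN i p : 0 < p.2 ->
    (fun y : 'rV[R]_n => dx i (fun p => - u p) (y, p.2)) = - (fun y => dx i u (y, p.2)).
  by move=> p0; apply/funext => y; rewrite dxN.
apply: classical_subsolution; first exact: powR_ge0.
- move=> p p0; have [dtu dxu dxxu] := classical_solution_derivable p0; split.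
  + exact: derivableN dtu.
  + by move=> i; exact: derivableN (dxu i).
  + by move=> i; rewrite dxxN//; exact: derivableN (dxxu i).
- move=> p p0; have [dtu _ dxxu] := classical_solution_derivable p0.
  have -> : dt (fun p => - u p) p = - dt u p by rewrite /dt !derive1E; exact: deriveN.
  have -> : laplacian (fun p => - u p) p = - laplacian u p.
    rewrite /laplacian -sumrN; apply: eq_bigr => i _.
    by rewrite {1}/dx dxxN//; exact: deriveN.
  by rewrite opprK; have [_ _ /(_ p p0) + _ _] := u_sol; lra.
Qed.

Lemma homogenization_estimate (c Lg L : R) (Psi : R -> R) (a b B K eta T : R) :
  0 < eps -> 0 < c -> 0 < Lg -> (forall x y, `|g x - g y| <= Lg * `|x - y|) ->
  corrector (fun y => g y / c) Psi a b B K ->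
  0 <= L -> (forall x y, `|u0 x - u0 y| <= L * `|x - y|) -> 0 < eta ->
  forall x t, 0 <= t <= T ->
    `|u (x, t) - (u0 x + c * t)| <=
      @homogenization_error R n a B K eps (eps `^ alpha) L eta T.
Proof.
move=> eps0 c0 Lg0 gL PsiP L0 u0L eta0 x t tT.
have [cu _ _ uinit ugrowth] := u_sol.
have k0 : 0 < eps `^ alpha by exact: powR_gt0.
have cg y : c * (g y / c) = g y by rewrite mulrCA divff ?mulr1// gt_eqF.
have scale y z : `|g (y / eps) - g (z / eps)| <= Lg / eps * `|y - z|.
  apply: (le_trans (gL _ _)).
  by rewrite -mulrBl normrM normfV (gtr0_norm eps0) mulrA mulrAC.
have lam0 : 0 <= Lg / eps by rewrite divr_ge0 ?ltW.
rewrite ler_norml; apply/andP; split.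
- have cNu : {within [set p | 0 <= p.2], continuous (fun p => - u p)}.
    by move=> p; apply: cvgN; exact: cu.
  have Nsub : subsolution (eps `^ alpha)
      (fun y => - c * (g (- (y / eps)) / c)) (fun p => - u p).
    have -> : (fun y => - c * (g (- (y / eps)) / c)) = (fun y => - g (- y / eps)).
      by apply/funext => y; rewrite mulNr cg mulNr.
    exact: classical_solution_opp_subsolution.
  have Ngrowth : tychonoff_growth (fun p => - u p).
    move=> S /ugrowth[C [al uC]]; exists C, al => p pI; rewrite normrN; exact: uC.
  have Nlip y z : `|- u (y, 0) - - u (z, 0)| <= L * `|y - z|.
    by rewrite -opprD normrN !uinit.
  have NF y z : `|- c * (g (- (y / eps)) / c) - - c * (g (- (z / eps)) / c)| <=
      Lg / eps * `|y - z|.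
    rewrite !mulNr !cg -opprD normrN -!mulNr; apply: le_trans (scale _ _) _.
    by rewrite -opprD normrN.
  have := subsolution_le (corrector_opp PsiP) k0 eps0 L0 lam0 eta0 NF cNu Nsub Ngrowth Nlip x tT.
  by rewrite uinit; lra.
- have sub : subsolution (eps `^ alpha) (fun y => c * (g (y / eps) / c)) u.
    have -> : (fun y => c * (g (y / eps) / c)) = (fun y => g (y / eps)).
      by apply/funext => y; rewrite cg.
    exact: classical_solution_subsolution.
  have ulip y z : `|u (y, 0) - u (z, 0)| <= L * `|y - z| by rewrite !uinit.
  have uF y z : `|c * (g (y / eps) / c) - c * (g (z / eps) / c)| <= Lg / eps * `|y - z|.
    by rewrite !cg.
  have := subsolution_le PsiP k0 eps0 L0 lam0 eta0 uF cu sub ugrowth ulip x tT.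
  by rewrite uinit; lra.
Qed.

End Classical.

Theorem theorem5p3 (R : realType) (n : nat) (g : R -> R)
    (u0 : 'rV[R]_n -> R) (alpha : R) (u : R -> 'rV[R]_n * R -> R)
    (g_lip : lipschitz g) (g_per : periodic g 1) (g_gt0 : forall y, 0 < g y)
    (u0_lip : lipschitz u0) (alpha_gt1 : 1 < alpha)
    (u_sol : forall eps : R, 0 < eps -> classical_solution g u0 alpha eps (u eps)) :
  {family compactly_in [set p : 'rV[R]_n * R | 0 <= p.2],
    u eps @[eps --> 0^'+] -->
      (fun p : 'rV[R]_n * R =>
         u0 p.1 + p.2 * (\int[lebesgue_measure]_(s in `[0, 1]) (g s)^-1)^-1)}.
Proof.
have [c0 [Psi [a [b [B [K PsiP]]]]]] := corrector_exists g_lip g_per g_gt0.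
set c := _^-1 in c0 PsiP *; clearbody c.
have [Lg Lg0 gL] := lipschitz_bound g_lip; have [L L0 u0L] := lipschitz_bound u0_lip.
apply/fam_cvgP => A [Apos cA] P /uniform_nbhs[E [entE EP]].
have [e e0 eE] : exists2 e : R, 0 < e & forall x y : R, `|x - y| < e -> E (x, y).
  move: entE; rewrite -entourage_from_ballE => -[e e0 eE]; exists e => // x y xy.
  by apply: eE; rewrite -ball_normE.
have [T T0 AT] : exists2 T : R, 0 < T & forall p, A p -> p.2 <= T.
  have [[p Ap]|A0] := pselect (A !=set0); last first.
    by exists 1 => // p Ap; exfalso; apply: A0; exists p.
  have csnd : {within A, continuous (snd : 'rV[R]_n * R -> R)}.
    by apply: continuous_subspaceT => q; exact: cvg_snd.
  have [q _ qmax] := compact_EVT_max (ex_intro _ _ Ap) cA csnd.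
  exists (`|q.2| + 1) => [|r /mem_set/qmax]; first by have := normr_ge0 q.2; lra.
  by have := ler_norm q.2; lra.
(* The cone costs L eta = e / 2; the other errors vanish with eps. *)
pose eta := e / (2 * L).
have eta0 : 0 < eta by rewrite divr_gt0// mulr_gt0.
have [[a0 _] _ _ _] := PsiP.
have small : \forall eps \near 0^'+,
    @homogenization_error R n a B K eps (eps `^ alpha) L eta T < e.
  pose c1 := n%:R * L / eta; pose c2 := 2 * n%:R * K * L ^+ 2 / a.
  pose err eps := 2 * B * eps + e / 2 + T * (eps `^ alpha * c1 + eps `^ (alpha - 1) * c2).
  have err0 : err eps @[eps --> 0^'+] --> 2 * B * 0 + e / 2 + T * (0 * c1 + 0 * c2).
    apply: cvgD.
      apply: cvgD; last exact: cvg_cst.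
      apply: cvgM; first exact: cvg_cst.
      exact: cvg_at_right_filter cvg_id.
    apply: cvgM; first exact: cvg_cst.
    apply: cvgD; (apply: cvgM; last exact: cvg_cst).
      by apply: powR_cvg0; lra.
    by apply: powR_cvg0; lra.
  have lt_e : 2 * B * 0 + e / 2 + T * (0 * c1 + 0 * c2) < e by lra.
  have err_lt := cvgr_lt _ err0 _ lt_e.
  near=> eps; have eps0 : 0 < eps by near: eps; exact: nbhs_right_gt.
  rewrite (_ : homogenization_error _ _ _ _ _ _ _ _ = err eps); first by near: eps; exact: err_lt.
  rewrite /err /homogenization_error -(@mulr_powRB1 _ eps alpha) ?(ltW eps0)//; last by lra.
  by rewrite /c1 /c2 /eta; field; rewrite !gt_eqF.
change (\forall eps \near 0^'+, P (u eps)).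
near=> eps; apply: EP => p Ap.
have eps0 : 0 < eps by near: eps; exact: nbhs_right_gt.
apply: eE; rewrite distrC mulrC; case: p Ap => x t Ap /=.
have tT : 0 <= t <= T by apply/andP; split; [exact: (Apos _ Ap)|exact: (AT _ Ap)].
apply: le_lt_trans (homogenization_estimate (u_sol eps eps0) eps0 c0 Lg0 gL PsiP (ltW L0) u0L eta0 x tT) _.
by near: eps.
Unshelve. all: by end_near. Qed.
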